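(* Let $n\geq 1$. The function $\varphi:\mathrm{O}_n\rtimes\mathbb{Z}_2\to\mathrm{COD}_n$ defined by $$\varphi((f,g))=(fg,\operatorname{sgn}(g))\qquad (f\in\mathrm{O}_n,\ g\in\{\mathbf{id},\mathbf{h}\})$$ is an isomorphism of monoids.
   Context: $[n]=\{1,\dots,n\}$. $\mathrm{O}_n$ is the monoid (under composition, $(fg)(x)=f(g(x))$) of all order-preserving functions $f:[n]\to[n]$. $\mathrm{OD}_n$ is the monoid of all functions $f:[n]\to[n]$ that are order-preserving or order-reversing. $\mathrm{COD}_n$ is the submonoid of $\mathrm{OD}_n\times\{\mathbf 1,-\mathbf 1\}$ (where $\{\mathbf 1,-\mathbf 1\}$ is the multiplicative group of order two) consisting of: the pairs $(f,\mathbf 1)$ with $f$ non-constant order-preserving, the pairs $(f,-\mathbf 1)$ with $f$ non-constant order-reversing, and the pairs $(c_z,\mathbf 1)$, $(c_z,-\mathbf 1)$ for every $z\in[n]$, where $c_z$ is the constant function with value $z$. Let $\mathbf{id}$ be the identity function of $[n]$ and $\mathbf{h}(x)=n+1-x$ the order-reversing bijection. Identify $\mathbb{Z}_2\simeq\{\mathbf{id},\mathbf{h}\}$ and let $\operatorname{sgn}(\mathbf{id})=\mathbf 1$, $\operatorname{sgn}(\mathbf{h})=-\mathbf 1$. (For $n=1$, $\{\mathbf{id},\mathbf{h}\}$ is to be read as a formal two-element group, both of whose elements act as the identity function.) $\mathbb{Z}_2$ acts on $\mathrm{O}_n$ by $g\ast f=gfg$, and $\mathrm{O}_n\rtimes\mathbb{Z}_2$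 is the set $\mathrm{O}_n\times\mathbb{Z}_2$ with product $(f_2,g_2)\cdot(f_1,g_1)=(f_2(g_2\ast f_1),\,g_2g_1)$. *)

(* Defs.v *)
From HB Require Import structures.
From mathcomp Require Import all_boot.

Set Implicit Arguments.
Unset Strict Implicit.
Unset Printing Implicit Defensive.

Local Open Scope group_scope.

(* The set [n] = {1, ..., n} is represented by 'I_n = {0, ..., n.-1}, so that *)
(* the reflection x |-> n + 1 - x becomes rev_ord.                            *)

(* An alias of {ffun 'I_n -> 'I_n}, whose own library product (for n > 0) is  *)
(* the pointwise one; here the product is composition.                        *)
Definition transf (n : nat) : Type := {ffun 'I_n -> 'I_n}.

HB.instance Definition _ n := Finite.on (transf n).

Section Transformations.
Variable n : nat.
Implicit Types f g : transf n.

Definition transf_id : transf n := [ffun x => x].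
Definition transf_comp f g : transf n := [ffun x => f (g x)].

Fact transf_compA : associative transf_comp.
Proof. by move=> f g k; apply/ffunP=> x; rewrite !ffunE. Qed.

Fact transf_comp1f : left_id transf_id transf_comp.
Proof. by move=> f; apply/ffunP=> x; rewrite !ffunE. Qed.

Fact transf_compf1 : right_id transf_id transf_comp.
Proof. by move=> f; apply/ffunP=> x; rewrite !ffunE. Qed.

HB.instance Definition _ :=
  isMonoid.Build (transf n) transf_compA transf_comp1f transf_compf1.

Lemma transf1E x : (1 : transf n) x = x.
Proof. exact: ffunE. Qed.

Lemma transfME f g x : (f * g) x = f (g x).
Proof. exact: ffunE. Qed.

Definition transf_cst (z : 'I_n) : transf n := [ffun=> z].

Definition order_preserving : pred (transf n) :=
  fun f => [forall x : 'I_n, forall y : 'I_n, (x <= y) ==> (f x <= f y)].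

Definition order_reversing : pred (transf n) :=
  fun f => [forall x : 'I_n, forall y : 'I_n, (x <= y) ==> (f y <= f x)].

Definition monotone : pred (transf n) :=
  fun f => order_preserving f || order_reversing f.

Definition is_cst : pred (transf n) := fun f => [exists z, f == transf_cst z].

Lemma order_preservingP f :
  reflect (forall x y : 'I_n, x <= y -> f x <= f y) (order_preserving f).
Proof.
apply: (iffP 'forall_forallP) => [H x y|H x y]; first exact/implyP.
by apply/implyP/H.
Qed.

Lemma order_reversingP f :
  reflect (forall x y : 'I_n, x <= y -> f y <= f x) (order_reversing f).
Proof.
apply: (iffP 'forall_forallP) => [H x y|H x y]; first exact/implyP.
by apply/implyP/H.
Qed.

Lemma order_preserving1 : order_preserving 1.
Proof. by apply/order_preservingP=> x y; rewrite !transf1E. Qed.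

Lemma order_preservingM f g :
  order_preserving f -> order_preserving g -> order_preserving (f * g).
Proof.
move=> /order_preservingP Hf /order_preservingP Hg.
by apply/order_preservingP=> x y /Hg /Hf; rewrite !transfME.
Qed.

Lemma order_preservingMr f g :
  order_reversing f -> order_reversing g -> order_preserving (f * g).
Proof.
move=> /order_reversingP Hf /order_reversingP Hg.
by apply/order_preservingP=> x y /Hg /Hf; rewrite !transfME.
Qed.

Lemma order_reversingMl f g :
  order_reversing f -> order_preserving g -> order_reversing (f * g).
Proof.
move=> /order_reversingP Hf /order_preservingP Hg.
by apply/order_reversingP=> x y /Hg /Hf; rewrite !transfME.
Qed.

Lemma order_reversingMr f g :
  order_preserving f -> order_reversing g -> order_reversing (f * g).
Proof.
move=> /order_preservingP Hf /order_reversingP Hg.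
by apply/order_reversingP=> x y /Hg /Hf; rewrite !transfME.
Qed.

Lemma is_cstMl f g : is_cst f -> is_cst (f * g).
Proof.
case/existsP=> z /eqP ->; apply/existsP; exists z.
by apply/eqP/ffunP=> x; rewrite transfME !ffunE.
Qed.

Lemma is_cstMr f g : is_cst g -> is_cst (f * g).
Proof.
case/existsP=> z /eqP ->; apply/existsP; exists (f z).
by apply/eqP/ffunP=> x; rewrite transfME !ffunE.
Qed.

Fact order_preserving_closed : monoid_closed order_preserving.
Proof. by split=> [|f g]; [exact: order_preserving1|exact: order_preservingM]. Qed.

Fact monotone_closed : monoid_closed monotone.
Proof.
split=> [|f g]; first by rewrite unfold_in /monotone order_preserving1.
rewrite !unfold_in => /orP[Hf|Hf] /orP[Hg|Hg]; apply/orP.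
- by left; apply: order_preservingM.
- by right; apply: order_reversingMr.
- by right; apply: order_reversingMl.
- by left; apply: order_preservingMr.
Qed.

End Transformations.

Definition O_ (n : nat) : Type := {f : transf n | order_preserving f}.
HB.instance Definition _ n := SubChoice.on (O_ n).
HB.instance Definition _ n := SubChoice_isSubMonoid.Build
  (transf n) (@order_preserving n) (O_ n) (@order_preserving_closed n).

Definition OD (n : nat) : Type := {f : transf n | monotone f}.
HB.instance Definition _ n := SubChoice.on (OD n).
HB.instance Definition _ n := SubChoice_isSubMonoid.Build
  (transf n) (@monotone n) (OD n) (@monotone_closed n).

(* The multiplicative group {1, -1}: Pos is 1 and Neg is -1.                  *)
Variant sign : Type := Pos | Neg.

Definition bool_of_sign s := if s is Pos then true else false.
Definition sign_of_bool b := if b is true then Pos else Neg.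
Fact bool_of_signK : cancel bool_of_sign sign_of_bool.
Proof. by case. Qed.
HB.instance Definition _ := Countable.copy sign (can_type bool_of_signK).

Definition sign_mul s t :=
  match s, t with Pos, Pos | Neg, Neg => Pos | _, _ => Neg end.

Fact sign_mulA : associative sign_mul. Proof. by do 3!case. Qed.
Fact sign_mul1s : left_id Pos sign_mul. Proof. by case. Qed.
Fact sign_muls1 : right_id Pos sign_mul. Proof. by case. Qed.
Fact sign_mulVs : left_inverse Pos id sign_mul. Proof. by case. Qed.
Fact sign_mulsV : right_inverse Pos id sign_mul. Proof. by case. Qed.
HB.instance Definition _ := isGroup.Build sign
  sign_mulA sign_mul1s sign_muls1 sign_mulVs sign_mulsV.

(* The two-element group {id, h}. It is formal for every n, since for n = 1   *)
(* the two functions id and h coincide; Z2_fun sends its elements to the      *)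
(* functions they stand for.                                                  *)
Variant Z2 : Type := Zid | Zh.

Definition bool_of_Z2 g := if g is Zid then true else false.
Definition Z2_of_bool b := if b is true then Zid else Zh.
Fact bool_of_Z2K : cancel bool_of_Z2 Z2_of_bool.
Proof. by case. Qed.
HB.instance Definition _ := Countable.copy Z2 (can_type bool_of_Z2K).

Definition Z2_mul g k :=
  match g, k with Zid, Zid | Zh, Zh => Zid | _, _ => Zh end.

Fact Z2_mulA : associative Z2_mul. Proof. by do 3!case. Qed.
Fact Z2_mul1g : left_id Zid Z2_mul. Proof. by case. Qed.
Fact Z2_mulg1 : right_id Zid Z2_mul. Proof. by case. Qed.
Fact Z2_mulVg : left_inverse Zid id Z2_mul. Proof. by case. Qed.
Fact Z2_mulgV : right_inverse Zid id Z2_mul. Proof. by case. Qed.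
HB.instance Definition _ := isGroup.Build Z2
  Z2_mulA Z2_mul1g Z2_mulg1 Z2_mulVg Z2_mulgV.

Definition sgn (g : Z2) : sign := if g is Zid then Pos else Neg.

Definition COD_pred (n : nat) : pred (OD n * sign) := fun p =>
  let f := val p.1 in
  [|| [&& ~~ is_cst f, order_preserving f & p.2 == Pos],
      [&& ~~ is_cst f, order_reversing f & p.2 == Neg]
    | is_cst f].

Fact COD_closed n : monoid_closed (@COD_pred n).
Proof.
split=> [|[f s] [g t]]; rewrite !unfold_in /COD_pred /=.
  by rewrite order_preserving1; case: is_cst.
have [Cf _|_] := boolP (is_cst (val f)); first by rewrite is_cstMl // !orbT.
have [Cg _|_] := boolP (is_cst (val g)); first by rewrite is_cstMr // !orbT.
case: (is_cst _); rewrite ?orbT //= !orbF.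
case: s t => [] [] /=; rewrite ?andbT ?andbF ?orbF /= => Hf Hg.
- by rewrite order_preservingM.
- by rewrite order_reversingMr ?orbT.
- by rewrite order_reversingMl ?orbT.
- by rewrite order_preservingMr.
Qed.

Definition COD (n : nat) : Type := {p : OD n * sign | COD_pred p}.
HB.instance Definition _ n := SubChoice.on (COD n).
HB.instance Definition _ n := SubChoice_isSubMonoid.Build
  (OD n * sign)%type (@COD_pred n) (COD n) (@COD_closed n).

Section SemidirectProduct.
Variable n : nat.
Implicit Types (f : O_ n) (g k : Z2).

Definition Z2_fun g : transf n := if g is Zid then 1 else [ffun x => rev_ord x].

Lemma Z2_funM g k : Z2_fun (g * k) = Z2_fun g * Z2_fun k.
Proof.
case: g k => [] [] /=; rewrite ?mulg1 ?mul1g //.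
by apply/ffunP=> x; rewrite transfME transf1E !ffunE rev_ordK.
Qed.

Lemma Z2_funK g : Z2_fun g * Z2_fun g = 1.
Proof. by rewrite -Z2_funM; case: g. Qed.

Lemma order_reversing_Zh : order_reversing (Z2_fun Zh).
Proof. by apply/order_reversingP=> x y le_xy; rewrite !ffunE /= leq_sub2l. Qed.

Fact Z2_act_subproof g f : order_preserving (Z2_fun g * val f * Z2_fun g).
Proof.
case: g; first by rewrite mul1g mulg1 (valP f).
apply: order_preservingMr order_reversing_Zh.
exact: order_reversingMl order_reversing_Zh (valP f).
Qed.

Definition Z2_act g f : O_ n := Sub (Z2_fun g * val f * Z2_fun g) (Z2_act_subproof g f).

Lemma Z2_act1 f : Z2_act 1 f = f.
Proof. by apply: val_inj; rewrite /= mul1g mulg1. Qed.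

Lemma Z2_actM g k f : Z2_act (g * k) f = Z2_act g (Z2_act k f).
Proof.
apply: val_inj => /=; rewrite {2}(_ : g * k = k * g) ?Z2_funM ?mulgA //.
by case: g k => [] [].
Qed.

Lemma Z2_act_id g : Z2_act g 1 = 1.
Proof. by apply: val_inj; rewrite /= mulg1 Z2_funK. Qed.

Lemma Z2_act_mul g f1 f2 : Z2_act g (f1 * f2) = Z2_act g f1 * Z2_act g f2.
Proof.
apply: val_inj => /=.
by rewrite !mulgA -(mulgA (Z2_fun g * val f1) (Z2_fun g)) Z2_funK mulg1.
Qed.

(* The set O_n x Z_2, wrapped in a record to keep its product apart from the  *)
(* direct one.                                                                *)
Record OsdZ2 : Type := SdPair { sd_fun : O_ n; sd_grp : Z2 }.

Definition pair_of_sd (p : OsdZ2) := (sd_fun p, sd_grp p).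
Definition sd_of_pair (p : O_ n * Z2) := SdPair p.1 p.2.
Fact pair_of_sdK : cancel pair_of_sd sd_of_pair.
Proof. by case. Qed.
HB.instance Definition _ := Choice.copy OsdZ2 (can_type pair_of_sdK).

Definition sd_one : OsdZ2 := SdPair 1 1.
Definition sd_mul (p2 p1 : OsdZ2) : OsdZ2 :=
  SdPair (sd_fun p2 * Z2_act (sd_grp p2) (sd_fun p1)) (sd_grp p2 * sd_grp p1).

Fact sd_mulA : associative sd_mul.
Proof.
by case=> [f3 g3] [f2 g2] [f1 g1]; rewrite /sd_mul /= Z2_act_mul Z2_actM !mulgA.
Qed.
Fact sd_mul1p : left_id sd_one sd_mul.
Proof. by case=> [f g]; rewrite /sd_mul /= Z2_act1 !mul1g. Qed.
Fact sd_mulp1 : right_id sd_one sd_mul.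
Proof. by case=> [f g]; rewrite /sd_mul /= Z2_act_id !mulg1. Qed.
HB.instance Definition _ := isMonoid.Build OsdZ2 sd_mulA sd_mul1p sd_mulp1.

Fact phi_monotone (p : OsdZ2) : monotone (val (sd_fun p) * Z2_fun (sd_grp p)).
Proof.
case: p => f [] /=; rewrite /monotone ?mulg1 ?(valP f) //.
by rewrite (order_reversingMr (valP f) order_reversing_Zh) orbT.
Qed.

Definition phi_OD (p : OsdZ2) : OD n :=
  Sub (val (sd_fun p) * Z2_fun (sd_grp p)) (phi_monotone p).

Fact phi_COD (p : OsdZ2) : COD_pred (phi_OD p, sgn (sd_grp p)).
Proof.
rewrite /COD_pred /=; case: (is_cst _); rewrite ?orbT //= orbF.
case: p => f [] /=; first by rewrite mulg1 (valP f).
by rewrite (order_reversingMr (valP f) order_reversing_Zh) orbT.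
Qed.

(* phi (f, g) = (f g, sgn g); phi_OD p is f g, seen in OD n.                  *)
Definition phi (p : OsdZ2) : COD n :=
  Sub (phi_OD p, sgn (sd_grp p)) (phi_COD p).

End SemidirectProduct.

Definition monoid_isomorphism (M N : monoidType) (u : M -> N) : Prop :=
  monoid_morphism u /\ bijective u.

(* Main.v *)
Require Import Defs.
From mathcomp Require Import all_boot.

(** The map phi multiplies in the first coordinate by the factor Z2_fun g,
    which is its own inverse.  This gives both halves of the statement.

    Multiplicativity: writing h1, h2 for the functions of g1, g2, the first
    coordinate of the image of (f2, g2) (f1, g1) is
    f2 (h2 f1 h2) (h2 h1) = (f2 h2) (f1 h1), because the two inner copies of h2
    cancel; and sgn is a group morphism.

    Bijectivity: sgn is a bijection, and once g is known from its sign, f is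
    recovered from f g as (f g) g.  The inverse therefore sends (u, s) to
    (u g, g) with sgn g = s, and the only thing to check is that u g preserves
    the order (lemma [COD_untwist]).  That is exactly what the shape of COD_n
    provides: a nonconstant u carries the sign that tells whether it preserves
    or reverses the order, and a constant u stays constant, hence order
    preserving, when multiplied by g, whatever the sign.  The argument is
    uniform in n because the group {id, h} is formal: for n = 1, where the
    functions id and h coincide, the sign still separates the two elements. *)

Local Open Scope group_scope.

Lemma sgnM : {morph sgn : g k / g * k}.
Proof. by do 2!case. Qed.

Definition Z2_of_sign (s : sign) : Z2 := if s is Pos then Zid else Zh.

Lemma sgnK : cancel sgn Z2_of_sign.
Proof. by case. Qed.

Lemma Z2_of_signK : cancel Z2_of_sign sgn.
Proof. by case. Qed.

Lemma is_cst_order_preserving n (f : transf n) : is_cst f -> order_preserving f.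
Proof.
by case/existsP=> z /eqP->; apply/order_preservingP=> x y _; rewrite !ffunE.
Qed.

(** Membership in COD_n says that the sign records the direction of every
    nonconstant function, so composing with the element of Z_2 of that sign
    turns a reversing function back into a preserving one. *)
Lemma COD_untwist n (c : COD n) :
  order_preserving (val (val c).1 * Z2_fun n (Z2_of_sign (val c).2)).
Proof.
case: c => [[u s] /= /or3P[/and3P[_ u_pres /eqP/= ->] | |u_cst]] /=.
- by rewrite mulg1.
- case/and3P=> _ u_rev /eqP/= ->.
  exact: order_preservingMr u_rev (order_reversing_Zh n).
- exact/is_cst_order_preserving/is_cstMl.
Qed.

Definition phi_inv {n : nat} (c : COD n) : OsdZ2 n :=
  SdPair (Sub _ (COD_untwist _ c)) (Z2_of_sign (val c).2).

Lemma phiK n : cancel (@phi n) phi_inv.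
Proof.
case=> f g; congr SdPair; last exact: sgnK.
by apply: val_inj; rewrite /= sgnK -mulgA Z2_funK mulg1.
Qed.

Lemma phi_invK n : cancel phi_inv (@phi n).
Proof.
move=> c; apply: val_inj; rewrite /= Z2_of_signK [RHS]surjective_pairing.
by congr (_, _); apply: val_inj; rewrite /= -mulgA Z2_funK mulg1.
Qed.

(** This is where the twist in the semidirect product is used: acting by g2 on
    f1 is conjugation by g2, and its right-hand factor cancels the g2 coming
    from the product of the group components. *)
Lemma phiM n : {morph @phi n : p q / p * q}.
Proof.
case=> [f2 g2] [f1 g1]; apply: val_inj => /=; rewrite sgnM.
congr (_, _); apply: val_inj => /=.
by rewrite Z2_funM !mulgA -(mulgA _ (Z2_fun n g2) (Z2_fun n g2)) Z2_funK mulg1.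
Qed.

Lemma phi1 n : @phi n 1 = 1.
Proof. by apply: val_inj; congr (_, _); apply: val_inj; rewrite /= mulg1. Qed.

Local Close Scope group_scope.

Theorem lemma4p2 (n : nat) (hn : 1 <= n) : monoid_isomorphism (@phi n).
Proof.
split; first by split; [exact: phi1 | exact: phiM].
exact: Bijective (@phiK n) (@phi_invK n).
Qed.
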